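(* The elementary cellular automata with numbers $9$, $27$, $28$, $41$ and $58$ are not (Von Neumann) regular as elements of the monoid $\mathrm{End}(\{0,1\}^{\mathbb{Z}})$.
   Context: The full shift $\{0,1\}^{\mathbb{Z}}$ carries the product topology and the shift map $\sigma(x)_i = x_{i+1}$. A cellular automaton on $\{0,1\}^{\mathbb{Z}}$ is a continuous shift-commuting function $\{0,1\}^{\mathbb{Z}} \to \{0,1\}^{\mathbb{Z}}$ (equivalently, a map for which there are some radius $r \in \mathbb{N}$ and a local rule such that $f(x)_i$ is determined by $x|_{[i-r,i+r]}$, independently of $i$). These form a monoid $\mathrm{End}(\{0,1\}^{\mathbb{Z}})$ under composition. For $n \in [0,255]$ with base-$2$ representation $b_7b_6\cdots b_1b_0$ (so $n = \sum_{k=0}^{7} b_k 2^k$), the elementary cellular automaton (ECA) number $n$ is the map $f : \{0,1\}^{\mathbb{Z}} \to \{0,1\}^{\mathbb{Z}}$ with $$f(x)_i = 1 \iff b_{4x_{i-1} + 2x_i + x_{i+1}} = 1.$$ An element $a$ of a semigroup $S$ is (Von Neumann) regular if there is $b \in S$ such that $aba = a$ and $bab = b$. *)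

(* Defs.v *)
From HB Require Import structures.
From mathcomp Require Import all_boot all_order all_algebra.
From mathcomp Require Import boolp classical_sets functions topology.

Set Implicit Arguments.
Unset Strict Implicit.
Unset Printing Implicit Defensive.

Import GRing.Theory.
Local Open Scope classical_set_scope.
Local Open Scope ring_scope.

(* [{ptws _ -> _}] carries the product topology and [bool] the discrete one. *)
Definition full_shift : Type := {ptws int -> bool}.

HB.instance Definition _ := Pointed.on full_shift.
HB.instance Definition _ := Nbhs.on full_shift.
HB.instance Definition _ := Topological.on full_shift.
HB.instance Definition _ := Uniform.on full_shift.

Definition shift (x : full_shift) : full_shift := fun i => x (i + 1).

Record cellular_automaton := CellularAutomaton {
  ca_fun :> full_shift -> full_shift;
  ca_continuous : continuous ca_fun;
  ca_shift : forall x, ca_fun (shift x) = shift (ca_fun x)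
}.

HB.instance Definition _ := gen_eqMixin cellular_automaton.
HB.instance Definition _ := gen_choiceMixin cellular_automaton.

Lemma ca_inj (f g : cellular_automaton) : ca_fun f = ca_fun g -> f = g.
Proof.
case: f g => [f fc fs] [g gc gs] /= fg; subst g.
by congr CellularAutomaton; exact: Prop_irrelevance.
Qed.

Fact ca_id_continuous : continuous (id : full_shift -> full_shift).
Proof. by move=> x A. Qed.

Definition ca_id : cellular_automaton :=
  @CellularAutomaton id ca_id_continuous (fun=> erefl).

Fact ca_comp_continuous (f g : cellular_automaton) :
  continuous (ca_fun f \o ca_fun g).
Proof.
by move=> x; apply: continuous_comp; exact: ca_continuous.
Qed.

Fact ca_comp_shift (f g : cellular_automaton) x :
  (f \o g) (shift x) = shift ((f \o g) x).
Proof. by rewrite /= !ca_shift. Qed.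

Definition ca_comp (f g : cellular_automaton) : cellular_automaton :=
  @CellularAutomaton (f \o g) (@ca_comp_continuous f g) (@ca_comp_shift f g).

Fact ca_compA : associative ca_comp.
Proof. by move=> f g h; exact: ca_inj. Qed.

Fact ca_comp1f : left_id ca_id ca_comp.
Proof. by move=> f; exact: ca_inj. Qed.

Fact ca_compf1 : right_id ca_id ca_comp.
Proof. by move=> f; exact: ca_inj. Qed.

HB.instance Definition _ :=
  isMonoid.Build cellular_automaton ca_compA ca_comp1f ca_compf1.

Definition vn_regular (S : semigroupType) (a : S) : Prop :=
  exists b : S, (a * b * a = a)%g /\ (b * a * b = b)%g.

Definition binary_digit (n k : nat) : bool := odd (n %/ 2 ^ k)%N.

(* Intended for n < 256: only the digits b_0, ..., b_7 of [n] are read. *)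
Definition eca_fun (n : nat) (x : full_shift) : full_shift :=
  fun i => binary_digit n (4 * x (i - 1)%R + 2 * x i + x (i + 1)%R)%N.

Fact eca_continuous n : continuous (eca_fun n).
Proof.
move=> x; apply/cvg_sup => i; apply/cvg_image.
  by apply/seteqP; split => // b _; exists (fun=> b).
move=> A /= xA.
have px j : nbhs x [set y : full_shift | y j = x j].
  apply: (@proj_continuous int (fun=> bool) j x [set b | b = x j]).
  exact: discrete_set1.
exists [set y : full_shift | A (y i)]; last first.
  apply/seteqP; split => [b [y ? <-]//|b Ab].
  by exists (fun=> b).
have : nbhs x [set y : full_shift | eca_fun n y i = eca_fun n x i].
  apply: filterS3 (px (i - 1)) (px i) (px (i + 1)) => y /= y1 y2 y3.
  by rewrite /eca_fun y1 y2 y3.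
by apply: filterS => y /= ->; exact: xA.
Qed.

Fact eca_shift n x : eca_fun n (shift x) = shift (eca_fun n x).
Proof. by apply/funext => i; rewrite /eca_fun /shift subrK addrK. Qed.

Definition eca (n : nat) : cellular_automaton :=
  CellularAutomaton (@eca_continuous n) (@eca_shift n).

(* Main.v *)
(** If [f g f = f], then [g] sends each point of the image of [f] to a preimage
    of it.  All five rules map 1^Z to 0^Z, so [g] sends 0^Z to a constant
    preimage c^Z, and by continuity and shift-commutation every finitely
    supported point [y] of the image has a preimage that is eventually [c] in
    both directions.  For each admissible [c] there is such a [y] which has no
    preimage of this kind.  Among the preimages of [y] with left tail [c], the
    pairs of adjacent symbols occurring left of the support of [y] lie in a set
    [L] closed under the transitions that produce 0; to the right of the support
    the tail [c] propagates back from infinity, and no word starting in [L] can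
    produce the support of [y] and end in [c c]. *)

Require Import Defs.
From mathcomp Require Import all_boot.
From mathcomp Require Import all_order all_algebra.
From mathcomp Require Import boolp classical_sets functions topology.
From mathcomp Require Import zify.

Set Implicit Arguments.
Unset Strict Implicit.
Unset Printing Implicit Defensive.

Import GRing.Theory.
Local Open Scope classical_set_scope.
Local Open Scope ring_scope.

Lemma cvg_full_shift (u : nat -> full_shift) (x : full_shift) :
  (forall i, \forall k \near \oo, u k i = x i) -> (u @ \oo --> x).
Proof.
move=> ux; apply/cvg_sup => i; apply/cvg_image.
  by apply/seteqP; split => // b _; exists (fun=> b).
move=> A /= xA.
exists [set y : full_shift | A (y i)]; last first.
  by apply/seteqP; split => [b [y ? <-]//|b Ab]; exists (fun=> b).
have : (\forall k \near \oo, A (u k i)); last by [].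
by near=> k; have -> : u k i = x i; [near: k; exact: ux | exact: nbhs_singleton].
Unshelve. all: by end_near.
Qed.

Lemma ca_translate (g : cellular_automaton) (x : full_shift) (k : int) :
  g (fun i => x (i + k)) = (fun i => g x (i + k)).
Proof.
elim: k => [|k IH|k IH].
- rewrite (_ : (fun i => x (i + 0)) = x); last by apply/funext => i; rewrite addr0.
  by apply/funext => i; rewrite addr0.
- have E (y : full_shift) :
      (fun i => y (i + k.+1%:Z)) = shift (fun i => y (i + k%:Z)).
    by apply/funext => i; rewrite /shift; congr (y _); lia.
  by rewrite E ca_shift IH -E.
- have E (y : full_shift) :
      (fun i => y (i - k%:Z)) = shift (fun i => y (i - k.+1%:Z)).
    by apply/funext => i; rewrite /shift; congr (y _); lia.
  move: IH; rewrite E ca_shift => IH; apply/funext => i.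
  have := congr1 (fun h : full_shift => h (i - 1)) IH.
  by rewrite /shift subrK => ->; congr (g x _); lia.
Qed.

(** The translates of [y] by [t k] converge pointwise to the constant [d], where [g] is continuous;
    coordinate 0 of their images is [g y (t k)]. *)
Lemma ca_eventually (g : cellular_automaton) (y : full_shift) (t : nat -> int)
    (d : bool) :
  (forall i, \forall k \near \oo, y (i + t k) = d) ->
  (\forall k \near \oo, g y (t k) = g (fun=> d) 0).
Proof.
move=> yd.
have /cvg_full_shift cy : forall i, (\forall k \near \oo,
  (fun k j => y (j + t k)) k i = (fun=> d) i) := yd.
have : nbhs (g (fun=> d)) [set h : full_shift | h 0 = g (fun=> d) 0].
  apply: (@proj_continuous int (fun=> bool) 0 _ [set b | b = g (fun=> d) 0]).
  exact: discrete_set1.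
move=> /(@ca_continuous g _) /cy gy.
have {}gy : \forall k \near \oo, g (fun j => y (j + t k)) 0 = g (fun=> d) 0.
  exact: gy.
by apply: filterS gy => k; rewrite ca_translate add0r.
Qed.

Definition local_rule (n : nat) (a b c : bool) : bool :=
  binary_digit n (4 * a + 2 * b + c)%N.

Lemma ecaE n (x : full_shift) i :
  eca n x i = local_rule n (x (i - 1)) (x i) (x (i + 1)).
Proof. by []. Qed.

Lemma eca_regular_tails n :
  vn_regular (eca n) -> local_rule n true true true = false ->
  exists2 c, local_rule n c c c = false &
    forall (x : full_shift) (m : nat),
      (forall i : int, i < 0 \/ m%:Z <= i -> eca n x i = false) ->
      exists z : full_shift, [/\ eca n z = eca n x,
        \forall k \near \oo, z (- k%:Z) = c &
        \forall k \near \oo, z k%:Z = c].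
Proof.
move=> [g [/(congr1 ca_fun) fgf _]] n1.
have {}fgf x : eca n (g (eca n x)) = eca n x := congr1 (@^~ x) fgf.
have f1 : eca n (fun=> true) = (fun=> false) by apply/funext => i; exact: n1.
pose c := g (fun=> false) 0.
have gc i : g (fun=> false) i = c.
  have := congr1 (fun h : full_shift => h 0) (ca_translate g (fun=> false) i).
  by rewrite add0r.
exists c.
  have := congr1 (fun h : full_shift => h 0) (fgf (fun=> true)).
  by rewrite f1 ecaE !gc.
move=> x m x0; exists (g (eca n x)); split; first exact: fgf.
- apply: ca_eventually => i; exists `|i|.+1 => //= k /= ik.
  by apply: x0; left; lia.
- apply: ca_eventually => i; exists (`|i| + m)%N => //= k /= ik.
  by apply: x0; right; lia.
Qed.

(** Read rightwards from the far left, where the pair is [c c], each 0 of the image is one step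
    inside [L]; the last one, cell -1, reaches positions -1 and 0. *)
Lemma left_tail_states n c (z : full_shift) (L : rel bool) :
  L c c -> (forall a b d, L a b -> local_rule n a b d = false -> L b d) ->
  (forall i, i < 0 -> eca n z i = false) ->
  (\forall k \near \oo, z (- k%:Z) = c) -> L (z (- 1)) (z 0).
Proof.
move=> Lc Lstep z0 [N _ zN].
suff H j : (j <= N)%N -> L (z (- (N - j).+1%:Z)) (z (- (N - j)%:Z)).
  by have := H N (leqnn N); rewrite subnn oppr0.
elim: j => [|j IH] jN.
  by rewrite subn0 !zN //=.
have /IH {}IH : (j <= N)%N by lia.
have e : (N - j = (N - j.+1).+1)%N by lia.
move: IH; rewrite e; move: (N - j.+1)%N => k IH.
apply: Lstep IH _; rewrite -(z0 (- k.+1%:Z)); last by lia.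
by rewrite ecaE; congr local_rule; congr (z _); lia.
Qed.

(** Backward induction from infinity: across each 0 of the image, [cP] moves the pair [c c] one
    position to the left. *)
Lemma right_tail_constant n c (z : full_shift) (m : nat) :
  (forall a, local_rule n a c c = false -> a = c) ->
  (forall i, m%:Z <= i -> eca n z i = false) ->
  (\forall k \near \oo, z k%:Z = c) -> z (m%:Z - 1) = c /\ z m%:Z = c.
Proof.
move=> cP z0 [N _ zN].
suff H j : (j <= N)%N ->
    z (m%:Z + (N - j)%:Z) = c /\ z (m%:Z + (N - j).+1%:Z) = c.
  have := H N (leqnn N); rewrite subnn addr0 => -[zm zm1]; split=> //.
  (* Cell [m] of the image also sees position [m - 1], hence one more use of [cP]. *)
  by apply: cP; rewrite -{1}zm -zm1; exact: z0.
elim: j => [|j IH] jN.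
  by rewrite subn0 -!PoszD !zN //=; lia.
have /IH {}IH : (j <= N)%N by lia.
have e : (N - j = (N - j.+1).+1)%N by lia.
move: IH; rewrite e; move: (N - j.+1)%N => k [zk1 zk2]; split=> //.
apply: cP; rewrite -{1}zk1 -zk2 -(z0 (m%:Z + k.+1%:Z)); last by lia.
by rewrite ecaE; congr local_rule; congr (z _); lia.
Qed.

(* [r] encodes the configuration ..., r 0, r 0, r 1, r 2, ... with [r 1] at the
   origin, so that [r i], [r i.+1], [r i.+2] determine cell [i] of the image;
   the same shift of indices applies to [w]. *)
Lemma eca_not_regular n :
  local_rule n true true true = false ->
  (forall c, local_rule n c c c = false ->
     (forall a, local_rule n a c c = false -> a = c) /\
     exists (r : nat -> bool) (m : nat) (L : rel bool),
     [/\ [/\ local_rule n (r 0) (r 0) (r 0) = false,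
             local_rule n (r 0) (r 0) (r 1) = false &
             forall i, (m <= i)%N ->
               local_rule n (r i) (r i.+1) (r i.+2) = false],
         L c c,
         forall a b d, L a b -> local_rule n a b d = false -> L b d &
         forall w : nat -> bool,
           (forall i, (i < m)%N -> local_rule n (w i) (w i.+1) (w i.+2) =
                              local_rule n (r i) (r i.+1) (r i.+2)) ->
           L (w 0) (w 1) -> ~ (w m = c /\ w m.+1 = c)]) ->
  ~ vn_regular (eca n).
Proof.
move=> n1 cert /eca_regular_tails /(_ n1) [c nc tails].
have [cP [r [m [L [[r000 r001 r0] Lc Lstep Lw]]]]] := cert c nc.
pose x : full_shift := fun i => if i is Posz k then r k.+1 else r 0.
have xE (k : nat) : eca n x k%:Z = local_rule n (r k) (r k.+1) (r k.+2).
  rewrite ecaE; congr local_rule.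
    by case: k => [//|k]; have -> : k.+1%:Z - 1 = k%:Z by lia.
  by have -> : k%:Z + 1 = k.+1%:Z by lia.
have xN i : i < 0 \/ m%:Z <= i -> eca n x i = false.
  case: i => [k [//|mk]|[|k] _].
  - by rewrite xE r0.
  - exact: r001.
  - exact: r000.
have [z [zx zl zr]] := tails x m xN.
apply: (Lw (fun k => z (k%:Z - 1))).
- move=> i _; rewrite -xE -zx ecaE; congr local_rule; congr (z _); lia.
- have -> : 1%:Z - 1 = 0 by [].
  apply: (left_tail_states Lc Lstep _ zl) => i i0.
  by rewrite zx; apply: xN; left.
- have -> : m.+1%:Z - 1 = m%:Z by lia.
  apply: (right_tail_constant cP _ zr) => i mi.
  by rewrite zx; apply: xN; right.
Qed.

Lemma eca9_not_regular : ~ vn_regular (eca 9).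
Proof.
apply: eca_not_regular => // -[] // _; split; first by case.
(* The image is 11 at cells 1 and 2. Backwards from [w 3], [w 4] = 11, cell 2 forces [w 2] = 0, and
   then 001 and 101 both give 0 at cell 1. *)
exists (fun k : nat => (k == 0) || ((4 < k)%N && odd k)), 3, (fun _ _ => true).
split=> // [|w H _ [w3 w4]].
  by split=> // -[|[|[|[|[|i]]]]] //= _; case: (odd i).
move: (H 0 isT) (H 1 isT) (H 2 isT); rewrite w3 w4.
by case: (w 0) (w 1) (w 2) => -[] [].
Qed.

Lemma eca27_not_regular : ~ vn_regular (eca 27).
Proof.
apply: eca_not_regular => // -[] // _; split; first by case.
(* The image is 11 at cells 0 and 1. Backwards from 11, the pair [w 0], [w 1] must be 00, which
   [orb] excludes. *)
exists (fun k : nat => (k == 0) || ((2 < k)%N && odd k)), 2, orb.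
split=> // [||w H Lw [w2 w3]].
- by split=> // -[|[|[|i]]] //= _; case: (odd i).
- by do 3!case.
move: (H 0 isT) (H 1 isT) Lw; rewrite w2 w3.
by case: (w 0) (w 1) => -[].
Qed.

Lemma eca28_not_regular : ~ vn_regular (eca 28).
Proof.
apply: eca_not_regular => // -[] // _; split; try by case.
(* Case [c = true]. The image is 11 at cells 0 and 1: cell 1 forces [w 1] = 0, but 001 and 101 both
   give 0. *)
- exists (fun k : nat => k == 1), 2, orb.
  split=> // [||w H Lw [w2 w3]].
  + by split=> // -[|[|i]].
  + by do 3!case.
  move: (H 0 isT) (H 1 isT) Lw; rewrite w2 w3.
  by case: (w 0) (w 1) => -[].
(* Case [c = false]. The image is a single 1 at cell 0. Both 010 and 011 give 1, so only pairs
   starting with 0 are reached from 00; then [w 0] = 0, but 000 gives 0. *)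
- exists (fun k : nat => k == 0), 1, (fun a _ => ~~ a).
  split=> // [||w H Lw [w1 w2]].
  + by split=> // -[|i].
  + by do 3!case.
  move: (H 0 isT) Lw; rewrite w1 w2.
  by case: (w 0).
Qed.

Lemma eca41_not_regular : ~ vn_regular (eca 41).
Proof.
apply: eca_not_regular => // -[] // _; split; first by case.
(* The image is 111 at cells 1 to 3. Backwards from 11, [w 3] = 0 and [w 2] = 1 are forced, but 010
   and 110 both give 0. *)
exists (fun k : nat => (3 %| k)%N && (k != 3)), 4, (fun _ _ => true).
split=> // [|w H _ [w4 w5]].
  split=> // -[|[|[|[|i]]]] // _; rewrite /= !andbT.
  have -> : i.+4.+2 = (i + 6)%N by lia.
  have -> : i.+4.+1 = (i + 5)%N by lia.
  have -> : i.+4 = (i + 4)%N by lia.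
  rewrite /dvdn -!(modnDml i).
  by case: (i %% 3)%N (ltn_pmod i (isT : 0 < 3)%N) => [|[|[|]]].
move: (H 0 isT) (H 1 isT) (H 2 isT) (H 3 isT); rewrite w4 w5.
by case: (w 0) (w 1) (w 2) (w 3) => -[] [] [].
Qed.

Lemma eca58_not_regular : ~ vn_regular (eca 58).
Proof.
apply: eca_not_regular => // c _; split; first by case: c => -[].
(* The image is a single 1 at cell 0. From [c c], outputs 0 reach only 11 and 10 if [c] is true,
   only 00 otherwise; so [w 0 = c], but [c c c] gives 0. *)
exists (fun k : nat => k == 0), 1, (fun a b => if c then a else ~~ (a || b)).
split=> [||a b d|w H Lw [w1 w2]].
- by split=> // -[|i].
- by case: c.
- by case: c a b d => -[] [] [].
- by move: (H 0 isT) Lw; rewrite w1 w2; case: c w1 w2 => _ _; case: (w 0).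
Qed.

Theorem theorem5 :
  [/\ ~ vn_regular (eca 9),
      ~ vn_regular (eca 27),
      ~ vn_regular (eca 28),
      ~ vn_regular (eca 41)
    & ~ vn_regular (eca 58)].
Proof.
split.
- exact: eca9_not_regular.
- exact: eca27_not_regular.
- exact: eca28_not_regular.
- exact: eca41_not_regular.
- exact: eca58_not_regular.
Qed.
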